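(* Fix $d\ge 3$ and an even positive integer $n$. The minimum degree of the graph $\mathcal{D}_{2d-1}(\mathbb{Q}_n^d)$ is at least $n^{d-2}/(320d^6)$, and each connected component of $\mathcal{D}_{2d-1}(\mathbb{Q}_n^d)$ contains at least $2^{n^{d-2}/(320d^6)}$ dimer configurations.
   Context: A dimer configuration on a graph $G$ is a perfect matching of $G$; its edges are dimers. Given a dimer configuration, an alternating cycle is a cycle of even length in $G$ in which every second edge is a dimer; switching it means exchanging dimer and non-dimer edges along the cycle, which yields another dimer configuration. For an integer $\ell\ge 2$, $\mathcal{D}_\ell(G)$ is the graph whose vertices are the dimer configurations on $G$, two being adjacent if one is obtained from the other by switching an alternating cycle of length at most $2\ell$. $\mathbb{Q}^d_n$ is the graph with vertex set $[n]^d$ ($[n]=\{1,\dots,n\}$), where $\mathbf{u},\mathbf{v}$ are adjacent if they differ in exactly one coordinate, by exactly $1$. *)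

(* Defs.v *)
From mathcomp Require Import all_boot.

Set Implicit Arguments.
Unset Strict Implicit.
Unset Printing Implicit Defensive.

Section FiniteGraph.
Variables (T : finType) (e : rel T).

Definition degree (x : T) : nat := #|[set y | e x y]|.

(* Every degree is at most #|T|, so the default value only matters for the
   empty graph. *)
Definition min_degree : nat := \big[minn/#|T|]_(x : T) degree x.

Definition components : {set {set T}} :=
  [set [set y | connect e x y] | x : T].

Definition edges : {set {set T}} :=
  [set [set p.1; p.2] | p : T * T & e p.1 p.2].

Definition perfect_matching (M : {set {set T}}) : bool :=
  (M \subset edges) && [forall x, #|[set f in M | x \in f]| == 1].

Definition dimer_config := {M : {set {set T}} | perfect_matching M}.

(* A cycle is the duplicate-free list of its vertices in cyclic order, so its
   length is the size of the list; [next c x] is the successor of [x]. *)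
Definition cycle_edges (c : seq T) : {set {set T}} :=
  [set [set x; next c x] | x in c].

(* [ucycleb] alone would accept the empty list and the list of the two ends of
   an edge, whence [2 < size c]. *)
Definition alternating_cycle (M : {set {set T}}) (c : seq T) : bool :=
  [&& ucycleb e c, 2 < size c, ~~ odd (size c)
    & all (fun x => ([set x; next c x] \in M)
                    != ([set next c x; next c (next c x)] \in M)) c].

Definition switch (M : {set {set T}}) (c : seq T) : {set {set T}} :=
  (M :\: cycle_edges c) :|: (cycle_edges c :\: M).

Definition switchable (l : nat) (M M' : {set {set T}}) : bool :=
  [exists k : 'I_(2 * l).+1, exists c : k.-tuple T,
    alternating_cycle M c && (M' == switch M c)].

Definition dimer_graph (l : nat) : rel dimer_config :=
  [rel M M' | switchable l (val M) (val M') || switchable l (val M') (val M)].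

End FiniteGraph.

(* The coordinates 1, ..., n are shifted to 0, ..., n - 1. *)
Definition grid (d n : nat) : rel {ffun 'I_d -> 'I_n} :=
  [rel u v : {ffun 'I_d -> 'I_n} |
    [exists i, [forall (j | j != i), u j == v j]
             && ((v i == (u i).+1 :> nat) || (u i == (v i).+1 :> nat))]].

(* Main.v *)
(* Write m for the partner map of a dimer configuration. Fix a vertex v. For a
   neighbour u of v with u <> m v, the points v, u, m u are either collinear, so
   that the dimer at u points at v, or three corners of a square, whose fourth
   corner is again a neighbour of v adjacent to m u. If no dimer points at v,
   iterating this map on the at most 2d neighbours of v gives an alternating
   cycle of length at most 2(2d-1) around v.

   A dimer points at no more than two vertices. Weigh vertices by
   sum_i x_i (n+1-x_i), with 1 <= x_i <= n: by concavity the two ends of a dimer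
   weigh at least 4 more than the two points it points at, hence the vertices
   at which no dimer points have total weight at least 2n^d, and there are at
   least 2n^(d-2)/d of them. Each cycle meets the cycles of at most 16d^2
   vertices, so at least n^(d-2)/(8d^3) of the cycles are pairwise disjoint, and
   these can be switched independently of each other. *)

Require Import Defs.
From HB Require Import structures.
From mathcomp Require Import all_boot all_order all_algebra.
From mathcomp Require Import reals exp.
From mathcomp Require Import zify lra.

Set Implicit Arguments.
Unset Strict Implicit.
Unset Printing Implicit Defensive.

(** * Finite unions and iteration *)

Lemma leq_card_bigcup (V W : finType) (A : {pred W}) (F : W -> {set V}) k :
  (forall i, i \in A -> #|F i| <= k) -> #|\bigcup_(i in A) F i| <= #|A| * k.
Proof.
move=> Fk; rewrite -sum_nat_const.
apply: leq_trans (_ : \sum_(i in A) #|F i| <= _); last exact: leq_sum.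
elim/big_rec2: _ => [|i n B _ leB]; first by rewrite cards0.
by rewrite (leq_trans (leq_card_setU _ _).1) ?leq_add2l.
Qed.

(** The first repetition among the iterates closes a cycle. As [f] may fail to be injective, [x]
    itself can lie off this cycle, hence the shift by [l]. *)
Lemma iter_periodic (T : finType) (f : T -> T) x :
  exists k l, iter k.+1 f (iter l f x) = iter l f x.
Proof.
have /trajectP[i lt_i E] := looping_order f x.
exists (order f x - i).-1, i.
by rewrite prednK ?subn_gt0 // -iterD subnK // ltnW.
Qed.

(** * Perfect matchings, partner maps and switching *)

Section Matchings.
Variables (T : finType) (e : rel T).
Hypotheses (e_sym : symmetric e) (e_irr : irreflexive e).
Implicit Types (M : {set {set T}}) (c : seq T).

Lemma set2_eqr (x y z : T) : x != y -> ([set x; z] == [set x; y]) = (z == y).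
Proof.
move=> nxy; apply/eqP/eqP => [E|-> //].
have := set22 x z; rewrite E => /set2P[zx|//].
by have := set22 x y; rewrite -E zx setUid => /set1P yx; rewrite yx eqxx in nxy.
Qed.

(** The unique dimer at [x] determines its other end, so membership in [M] becomes an equation
    between vertices, the form in which the grid argument uses it. *)
Lemma perfect_matching_partner M : perfect_matching e M ->
  exists m : T -> T,
    (forall x y, ([set x; y] \in M) = (y == m x)) /\ (forall x, e x (m x)).
Proof.
case/andP=> /subsetP sM /forallP cM.
have ex x : exists y, (forall z, ([set x; z] \in M) = (z == y)) /\ e x y.
  have /cards1P[f Ef] := cM x.
  have : f \in [set g in M | x \in g] by rewrite Ef set11.
  rewrite inE => /andP[fM xf]; have /imsetP[[a b]] := sM _ fM.
  rewrite inE /= => eab fE.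
  have [y fy exy] : exists2 y, f = [set x; y] & e x y.
    move: xf; rewrite fE => /set2P[]->; first by exists b.
    by exists a; rewrite 1?setUC // e_sym.
  have nxy : x != y by apply: contraTneq exy => ->; rewrite e_irr.
  exists y; split=> // z; rewrite -(set2_eqr _ nxy) -fy -in_set1 -Ef inE.
  by rewrite set21 andbT.
by have [m mP] := fin_all_exists ex; exists m; split=> [x y|x]; case: (mP x).
Qed.

Lemma partner_inv M (m : T -> T) :
  (forall x y, ([set x; y] \in M) = (y == m x)) -> involutive m.
Proof. by move=> mP x; apply/eqP; rewrite eq_sym -mP setUC mP. Qed.

Lemma involution_matching (m : T -> T) : involutive m ->
  (forall x, e x (m x)) -> perfect_matching e [set [set x; m x] | x : T].
Proof.
move=> mK em; apply/andP; split.
  apply/subsetP=> f /imsetP[x _ ->]; apply/imsetP.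
  by exists (x, m x); rewrite ?inE /=.
apply/forallP=> x; apply/cards1P; exists [set x; m x].
apply/setP=> f; rewrite !inE; apply/andP/eqP => [[/imsetP[y _ ->]]|->].
  by case/set2P=> ->; rewrite ?mK 1?setUC.
by rewrite set21; split=> //; apply: imset_f.
Qed.

Lemma in_switch M c f : (f \in switch M c) = (f \in M) (+) (f \in cycle_edges c).
Proof. by rewrite !inE; case: (f \in M); case: (f \in _). Qed.

Lemma cycle_edges_sub c f x : f \in cycle_edges c -> x \in f -> x \in c.
Proof. by case/imsetP=> y yc -> /set2P[]->; rewrite ?mem_next. Qed.

(** Off the cycle the dimer at [x] is kept; on the cycle, exactly one of the two cycle edges at [x]
    is a dimer, and switching replaces it by the other. *)
Lemma switch_perfect M c : perfect_matching e M -> alternating_cycle e M c ->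
  perfect_matching e (switch M c).
Proof.
case/andP=> /subsetP sM /forallP cM.
case/and4P=> /andP[cyc uc] _ _ /allP alt.
apply/andP; split.
  apply/subsetP=> f; rewrite !inE => /orP[]/andP[fc fM]; first exact: sM.
  case/imsetP: fM => x xc ->; apply/imsetP; exists (x, next c x) => //.
  by rewrite inE; apply: next_cycle.
apply/forallP=> x; have /cards1P[f Ef] := cM x.
have Mx (g : {set T}) : x \in g -> (g \in M) = (g == f).
  by move=> xg; move/setP/(_ g): Ef; rewrite !inE xg andbT.
have xf : x \in f by have := set11 f; rewrite -Ef inE => /andP[].
apply/cards1P; case: (boolP (x \in c)) => xc; last first.
  exists f; rewrite -Ef; apply/setP=> g; rewrite [LHS]inE [RHS]inE in_switch.
  case: (boolP (x \in g)) => xg; last by rewrite !andbF.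
  rewrite !andbT; case: (boolP (g \in cycle_edges c)); rewrite ?addbF //.
  by move/cycle_edges_sub/(_ xg) => xc'; rewrite xc' in xc.
set a := [set prev c x; x]; set b := [set x; next c x].
have ceE (g : {set T}) : x \in g -> (g \in cycle_edges c) = (g == a) || (g == b).
  move=> xg; apply/imsetP/orP => [[y yc gE]|].
    move: xg; rewrite gE => /set2P[E|E]; [right | left].
      by rewrite /b E.
    by rewrite /a {1}E prev_next // -E.
  case=> /eqP->; last by exists x.
  by exists (prev c x); rewrite ?mem_prev // next_prev.
have xa : x \in a by rewrite set22.
have xb : x \in b by rewrite set21.
(* Alternation at [prev c x] compares the two cycle edges [a] and [b] at [x]: exactly one of them is
   the old dimer [f]. *)
have := alt (prev c x); rewrite mem_prev next_prev // -/a -/b => /(_ xc).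
rewrite !Mx // => ab.
exists (if a == f then b else a); apply/setP=> g; rewrite inE [RHS]inE in_switch.
case: (boolP (x \in g)) => xg; last first.
  rewrite andbF; symmetry; apply: contraNF xg => /eqP->; by case: ifP.
rewrite andbT ceE // Mx //; move: ab.
case: (altP (a =P f)) => [<-|naf].
  case: (altP (b =P a)) => // nba _.
  by case: (altP (g =P a)) => [->|]; rewrite ?addFb // eq_sym (negbTE nba).
case: (altP (b =P f)) => // bf _; rewrite -bf in naf *.
case: (altP (g =P b)) => [->|]; last by rewrite orbF addFb.
by rewrite orbT eq_sym (negbTE naf).
Qed.

(** * Alternating cycles built from a partner map *)

Definition interleave (m : T -> T) (s : seq T) := flatten [seq [:: u; m u] | u <- s].

Lemma size_interleave m s : size (interleave m s) = 2 * size s.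
Proof. by elim: s => //= u s; rewrite /interleave /= => ->; rewrite mulnS. Qed.

Lemma mem_interleave m s x : involutive m ->
  (x \in interleave m s) = (x \in s) || (m x \in s).
Proof.
move=> mK; elim: s => //= u s IH; rewrite !inE -/(interleave m s) IH.
by rewrite -(inv_eq mK) !orbA; congr (_ || _); rewrite -!orbA; congr (_ || _); rewrite orbC.
Qed.

Lemma next_neq c x : uniq c -> 1 < size c -> x \in c -> next c x != x.
Proof.
move=> uc sc xc; have [i s E] := rot_to xc.
rewrite -(next_rot i uc) E; move: uc sc; rewrite -(rot_uniq i) -(size_rot i) E.
case: s {E} => //= y s; rewrite inE negb_or eqxx => /andP[/andP[nxy _] _] _.
by rewrite eq_sym.
Qed.

(** The dimers from [u] to [m u] alternate with the edges from [m u] to the successor of [u] in [s].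
    The colour separates [s] from its partners, which excludes repeated vertices. *)
Lemma interleave_alternating M (m : T -> T) (s : seq T) (col : pred T) :
  (forall x y, ([set x; y] \in M) = (y == m x)) -> (forall x, e x (m x)) ->
  uniq s -> 1 < size s -> cycle (fun u u' => e (m u) u') s ->
  {in s, forall u, col u && ~~ col (m u)} ->
  alternating_cycle e M (interleave m s).
Proof.
move=> mP em us ss cs colP; have mK := partner_inv mP.
set c := interleave m s; pose t := next s.
(* [g] is the successor map of [c]; the colour of [x] tells whether [x] belongs to [s] or is a
   partner. *)
pose g x := if col x then m x else t (m x).
have ts u : u \in s -> t u \in s by rewrite mem_next.
have gs u : u \in s -> g u = m u by rewrite /g => /colP/andP[->].
have gm u : u \in s -> g (m u) = t u.
  by rewrite /g => /colP/andP[_ /negbTE->]; rewrite mK.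
have cg : fcycle g c.
  rewrite {}/c; have := cycle_next us; rewrite -/t.
  case: (s) gs gm => //= u l gs gm.
  (* The induction needs a path with an arbitrary end [z]; taking [x] and [z] both equal to [u]
     closes the cycle. *)
  suff H x z l' : {subset x :: l' <= u :: l} -> fpath t x (rcons l' z) ->
       fpath g x (m x :: rcons (interleave m l') z) by apply: H.
  elim: l' x => [|y l' IH] x sub /=.
    by case/andP=> /eqP<- _; rewrite gs ?gm ?eqxx ?sub ?mem_head.
  case/andP=> /eqP E p; subst y; rewrite gs ?gm ?eqxx ?sub ?mem_head //=.
  by apply: IH p => i il; apply: sub; rewrite in_cons il orbT.
have memc x : (x \in c) = (x \in s) || (m x \in s) by apply: mem_interleave.
have nc x : x \in c -> next c x = g x.
  by move=> xc; have /eqP := next_cycle cg xc.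
have uc : uniq c.
  rewrite /c; elim: (s) us colP => //= u l IH /andP[ul ll] colP.
  rewrite -/(interleave m l) !inE !mem_interleave // mK !negb_or ul IH //=; last first.
    by move=> x xl; apply: colP; rewrite inE xl orbT.
  have /andP[cu ncu] := colP u (mem_head _ _).
  have ml : m u \notin l.
    apply: contra ncu => ml; by have := colP (m u); rewrite inE ml orbT => /(_ isT)/andP[].
  by rewrite ml !andbT; apply: contraNneq ncu => <-.
have ce : cycle e c.
  apply: (sub_in_cycle _ (allss c) cg) => x y /=.
  rewrite !memc => xc _ /eqP<-.
  case/orP: xc => xc; first by rewrite gs.
  by rewrite -[x]mK gm //; have := next_cycle cs xc.
rewrite /alternating_cycle /ucycleb ce uc size_interleave.
have -> : 2 < 2 * size s by lia.
rewrite oddM /=.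
apply/allP=> x xc; rewrite (nc (next c x)) ?mem_next // (nc x) //.
(* Were [t u] equal to [u], the edge from [m u] to [t u] would itself be a dimer; this is where [s]
   needs two vertices. *)
have nt u : u \in s -> t u != u by move=> u_s; apply: next_neq.
move: xc; rewrite memc; case/orP=> [xs|].
  by rewrite gs // gm // !mP mK eqxx (negbTE (nt _ _)).
move: (m x) (mK x) => u <- u_s; rewrite gm // gs ?ts // !mP mK eqxx.
by rewrite (negbTE (nt _ _)).
Qed.

(** * Independent switching of disjoint cycles *)

Section DisjointCycles.
Variables (l : nat) (M0 : dimer_config e) (V : finType) (I : {set V}) (c : V -> seq T).
Hypothesis c_alt : forall i, i \in I -> alternating_cycle e (val M0) (c i).
Hypothesis c_size : forall i, i \in I -> size (c i) <= 2 * l.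
Hypothesis c_disj : forall i j x, i \in I -> j \in I -> x \in c i -> x \in c j -> i = j.

(** Switching all cycles of [J] at once, by a formula that involves no order on [J]. *)
Definition multi_switch (J : {set V}) : {set {set T}} :=
  [set f | (f \in val M0) (+) [exists i in J, f \in cycle_edges (c i)]].

Lemma cycle_edges_disj i j f : i \in I -> j \in I ->
  f \in cycle_edges (c i) -> f \in cycle_edges (c j) -> i = j.
Proof.
move=> iI jI /imsetP[x xc ->] /cycle_edges_sub /(_ (set21 _ _)).
exact: c_disj.
Qed.

Lemma in_multi_switch (J : {set V}) i f : J \subset I -> i \in I ->
  f \in cycle_edges (c i) -> (f \in multi_switch J) = (f \in val M0) (+) (i \in J).
Proof.
move=> /subsetP JI iI fi; rewrite inE; congr (_ (+) _).
apply/existsP/idP => [[j /andP[jJ fj]]|iJ]; last by exists i; rewrite iJ.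
by rewrite (cycle_edges_disj iI (JI _ jJ) fi fj).
Qed.

Lemma multi_switchU1 (J : {set V}) i : J \subset I -> i \in I -> i \notin J ->
  multi_switch (i |: J) = switch (multi_switch J) (c i).
Proof.
move=> JI iI iJ; apply/setP=> f; rewrite in_switch.
case: (boolP (f \in cycle_edges (c i))) => fi.
  rewrite !(in_multi_switch _ iI fi) ?subUset ?sub1set ?iI // setU11.
  by rewrite (negbTE iJ) addbF.
rewrite addbF !inE; congr (_ (+) _); apply/existsP/existsP => -[j].
  rewrite !inE => /andP[/orP[/eqP->|jJ] fj]; first by rewrite fj in fi.
  by exists j; rewrite jJ.
by case/andP=> jJ fj; exists j; rewrite !inE jJ orbT.
Qed.

(** Disjoint cycles share no edge, so switching the others leaves the dimers on [c i] as they
    were. *)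
Lemma multi_switch_alt (J : {set V}) i : J \subset I -> i \in I -> i \notin J ->
  alternating_cycle e (multi_switch J) (c i).
Proof.
move=> JI iI iJ; have /and4P[uc s2 os /allP alt] := c_alt iI.
rewrite /alternating_cycle uc s2 os; apply/allP=> x xc.
have E y : y \in c i -> ([set y; next (c i) y] \in multi_switch J)
    = ([set y; next (c i) y] \in val M0).
  move=> yc; rewrite (in_multi_switch JI iI) ?(negbTE iJ) ?addbF //.
  exact: imset_f.
by rewrite !E ?mem_next //; apply: alt.
Qed.

Lemma switchableI M c1 : alternating_cycle e M c1 -> size c1 <= 2 * l ->
  switchable e l M (switch M c1).
Proof.
move=> ac sc; apply/existsP; exists (inord (size c1)); apply/existsP.
have sE : size c1 == (inord (size c1) : 'I_(2 * l).+1) by rewrite inordK.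
by exists (Tuple sE); rewrite /= ac eqxx.
Qed.

(** The cycles are switched one at a time, each step being an edge of the dimer graph. *)
Lemma multi_switch_connect (J : {set V}) : J \subset I ->
  exists2 M : dimer_config e, val M = multi_switch J & connect (dimer_graph l) M0 M.
Proof.
have [k] := ubnP #|J|; elim: k J => // k IH J leJ JI.
have [->|[i iJ]] := set_0Vmem J.
  exists M0; rewrite ?connect0 //; apply/setP=> f; rewrite inE.
  by rewrite (_ : [exists i in _, _] = false) ?addbF //; apply/existsP=> -[i]; rewrite inE.
have iI := subsetP JI i iJ.
have J'I : J :\ i \subset I by apply: subset_trans JI; apply: subsetDl.
have iJ' : i \notin J :\ i by rewrite !inE eqxx.
have [|M EM cM] := IH (J :\ i) _ J'I; first by move: leJ; rewrite (cardsD1 i) iJ.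
have altM : alternating_cycle e (val M) (c i) by rewrite EM multi_switch_alt.
exists (Sub (switch (val M) (c i)) (switch_perfect (valP M) altM)).
  by rewrite SubK EM -multi_switchU1 // setD1K.
apply: connect_trans cM (connect1 _).
by rewrite /dimer_graph /= switchableI ?c_size.
Qed.

Lemma cycle_edge_exists i : i \in I -> exists f, f \in cycle_edges (c i).
Proof.
move=> /c_alt/and4P[_ + _ _]; case: (c i) => // x s _.
by eexists; apply: imset_f; apply: mem_head.
Qed.

(** Whether [i] lies in [J] can be read off from any single edge of [c i]. *)
Lemma multi_switch_inj : {in powerset I &, injective multi_switch}.
Proof.
move=> J K; rewrite !inE => JI KI E; apply/setP=> i.
have [iI|iI] := boolP (i \in I); last first.
  have notin (A : {set V}) : A \subset I -> (i \in A) = false.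
    by move/subsetP=> AI; apply: contraNF iI => /AI.
  by rewrite !notin.
have [f fi] := cycle_edge_exists iI.
have := congr1 (fun A : {set {set T}} => f \in A) E.
by rewrite /= !(in_multi_switch _ iI fi) // => /addbI.
Qed.

(** Switching one cycle of the family gives a neighbour of [M0], and different cycles give different
    neighbours. *)
Lemma leq_degree_disjoint : #|I| <= degree (@dimer_graph _ e l) M0.
Proof.
have ex i : exists M : dimer_config e,
    i \in I -> val M = multi_switch [set i] /\ dimer_graph l M0 M.
  have [iI|_] := boolP (i \in I); last by exists M0.
  have E : multi_switch [set i] = switch (val M0) (c i).
    rewrite -[[set i]]setU0 multi_switchU1 ?sub0set ?inE //; congr switch.
    apply/setP=> f; rewrite inE (_ : [exists j in _, _] = false) ?addbF //.
    by apply/existsP=> -[j]; rewrite inE.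
  exists (Sub (switch (val M0) (c i)) (switch_perfect (valP M0) (c_alt iI))) => _.
  by rewrite SubK E /dimer_graph /= switchableI ?c_size ?c_alt.
have [g gP] := fin_all_exists ex.
have ginj : {in I &, injective g}.
  move=> i j iI jI /(congr1 val); rewrite (gP i iI).1 (gP j jI).1.
  by move/multi_switch_inj; rewrite !inE !sub1set => /(_ iI jI)/set1_inj.
rewrite -(card_in_imset ginj); apply: subset_leq_card.
by apply/subsetP=> _ /imsetP[i iI ->]; rewrite inE; case: (gP i iI).
Qed.

(** Each subset of [I] yields its own configuration in the component of [M0]. *)
Lemma leq_component_disjoint :
  2 ^ #|I| <= #|[set M | connect (@dimer_graph _ e l) M0 M]|.
Proof.
have ex J : exists M : dimer_config e,
    J \in powerset I -> val M = multi_switch J /\ connect (dimer_graph l) M0 M.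
  have [|_] := boolP (J \in powerset I); last by exists M0.
  by rewrite inE => /multi_switch_connect[M]; exists M.
have [g gP] := fin_all_exists ex.
have ginj : {in powerset I &, injective g}.
  move=> J K JI KI /(congr1 val); rewrite (gP J JI).1 (gP K KI).1.
  exact: multi_switch_inj.
rewrite -card_powerset -(card_in_imset ginj); apply: subset_leq_card.
by apply/subsetP=> _ /imsetP[J JI ->]; rewrite inE; case: (gP J JI).
Qed.

End DisjointCycles.

(* In a maximal disjoint subfamily, every [v] in [G] is [near] a vertex of a
   chosen cycle. *)
Lemma disjoint_subfamily (V : finType) (G : {set V}) (c : V -> seq T)
    (near : T -> {set V}) (a b : nat) :
  (forall v, v \in G -> 0 < size (c v) <= a) ->
  (forall v x, v \in G -> x \in c v -> v \in near x) ->
  (forall x, #|near x| <= b) ->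
  exists I : {set V}, [/\ I \subset G,
    forall i j x, i \in I -> j \in I -> x \in c i -> x \in c j -> i = j
    & #|G| <= #|I| * (a * b)].
Proof.
move=> c_size c_near near_b.
pose P (I : {set V}) := (I \subset G) && [forall i in I, forall j in I,
  (i != j) ==> ~~ has (mem (c i)) (c j)].
have [I /maxsetP[/andP[IG /'forall_in_'forall_in_implyP disj] maxI] _] :
    {I | maxset P I & set0 \subset I}.
  by apply: maxset_exists; rewrite /P sub0set; apply/forall_inP=> i; rewrite inE.
exists I; split=> // [i j x iI jI xi xj|].
  apply: contraTeq isT => nij; have /hasPn/(_ _ xj) := disj i iI j jI nij.
  by rewrite /= xi.
have cover : G \subset \bigcup_(i in I) \bigcup_(x in c i) near x.
  apply/subsetP=> v vG; apply: contraT => nv.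
  have far i : i \in I -> ~~ has (mem (c i)) (c v).
    move=> iI; apply: contra nv => /hasP[x xv xi].
    by apply/bigcupP; exists i => //; apply/bigcupP; exists x => //; apply: c_near.
  (* [far] at [v] itself would make [c v] disjoint from itself, impossible for a nonempty cycle. *)
  have nvI : v \notin I.
    apply: contra nv => vI; have := far v vI.
    by have := c_size v vG; case: (c v) => // x s _ /hasPn/(_ x (mem_head _ _)); rewrite /= mem_head.
  have PvI : P (v |: I).
    rewrite /P subUset sub1set vG IG; apply/'forall_in_'forall_in_implyP=> i + j.
    rewrite !inE => /predU1P[->|iI] /predU1P[->|jI]; rewrite ?eqxx //.
    - by rewrite has_sym far.
    - by rewrite far.
    - exact: disj.
  by case/negP: nvI; rewrite -(maxI _ PvI) ?setU11 ?subsetUr.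
apply: leq_trans (subset_leq_card cover) _.
apply: leq_card_bigcup => i iI; have /andP[_ sz] := c_size i (subsetP IG i iI).
apply: leq_trans (leq_card_bigcup _) _; first by move=> x _; apply: near_b.
by rewrite leq_mul2r (leq_trans (card_size _) sz) orbT.
Qed.
End Matchings.

(** * Geometry of the grid and the cycle around a vertex *)

Section Grid.
Variables d n : nat.
Notation V := {ffun 'I_d -> 'I_n}.
Implicit Types u v w : V.

Lemma gridP u v : reflect (exists2 i, forall j, j != i -> u j = v j &
    v i = (u i).+1 :> nat \/ u i = (v i).+1 :> nat) (grid u v).
Proof.
apply: (iffP existsP) => -[i].
  case/andP=> /forall_inP E /orP uv; exists i; first by move=> j /E/eqP.
  by case: uv => /eqP; [left | right].
move=> E uv; exists i; apply/andP; split.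
  by apply/forall_inP=> j /E->.
by apply/orP; case: uv => /eqP; [left | right].
Qed.

Lemma grid_sym : symmetric (@grid d n).
Proof.
by move=> u v; apply/gridP/gridP => -[i E uv]; exists i;
  [move=> j /E | case: uv; [right | left] | move=> j /E | case: uv; [right | left]].
Qed.

(** The chessboard colouring, which makes the grid bipartite. *)
Definition odd_vertex v := odd (\sum_i v i).

Lemma odd_vertex_grid u v : grid u v -> odd_vertex v = ~~ odd_vertex u.
Proof.
case/gridP=> i E uv; rewrite /odd_vertex (bigD1 i) //= [in RHS](bigD1 i) //=.
rewrite (eq_bigr (fun j => nat_of_ord (u j))); last by move=> j /E->.
by case: uv => ->; rewrite !oddD /=; case: odd; case: odd.
Qed.

Lemma grid_irr : irreflexive (@grid d n).
Proof. by move=> u; apply/negbTE/negP=> /odd_vertex_grid; case: odd_vertex. Qed.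

Lemma card_grid_nbhd v : #|[set u | grid v u]| <= 2 * d.
Proof.
(* A coordinate and a direction determine a neighbour; a step out of the box stays at [v], which is
   harmless for an upper bound. *)
pose step (p : 'I_d * bool) : V := [ffun k => if k == p.1 then
  insubd (v k) (if p.2 then (v k).+1 else (v k).-1) else v k].
have -> : 2 * d = #|[set: 'I_d * bool]|.
  by rewrite cardsT card_prod card_ord card_bool mulnC.
apply: leq_trans (leq_imset_card step _); apply: subset_leq_card.
apply/subsetP=> u; rewrite inE => /gridP[i E uv]; apply/imsetP.
exists (i, u i == (v i).+1 :> nat); rewrite ?inE //.
apply/ffunP=> k; rewrite ffunE /=; case: (altP (k =P i)) => [->|/E->] //.
apply: val_inj; rewrite val_insubd /=; case: eqP => [<-|ne]; first by rewrite ltn_ord.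
by case: uv => // ->; rewrite ltn_ord.
Qed.

(** Moving in a coordinate other than the one separating [v] from [w] avoids [w]. *)
Lemma grid_nbr_neq v w : 1 < n -> 1 < d -> grid v w -> exists2 u, grid v u & u != w.
Proof.
move=> n1 d1 /gridP[j E vw].
have [i nij] : exists i : 'I_d, i != j.
  case: (altP (j =P Ordinal (ltnW d1))) => [->|]; last by rewrite eq_sym; eexists; eassumption.
  by exists (Ordinal d1).
have [a av] : exists a : 'I_n, a = (v i).+1 :> nat \/ v i = a.+1 :> nat.
  have := ltn_ord (v i); case: (posnP (v i)) => [v0 _|vi lt].
    by exists (Ordinal n1); left; rewrite /= v0.
  by exists (Ordinal (leq_ltn_trans (leq_pred _) lt)); right; rewrite /= prednK.
exists [ffun k => if k == i then a else v k].
  apply/gridP; exists i => [k|]; rewrite ffunE ?eqxx //.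
  by move=> /negbTE->.
apply/eqP=> /ffunP/(_ i); rewrite ffunE eqxx -E // => E'.
by move: av; rewrite E'; lia.
Qed.

(* [v], [u], [w] are consecutive points of a line: the dimer [uw] points at [v]. *)
Definition straight v u w := [forall k, v k + w k == (u k).*2].

(** For steps in different coordinates this is [v + w - u], written without arithmetic in ['I_n]. *)
Definition corner v u w : V := [ffun k => if u k == w k then v k else w k].

Lemma cornerP v u w : grid v u -> grid u w -> w != v -> ~~ straight v u w ->
  [/\ grid v (corner v u w), grid w (corner v u w) & corner v u w != u].
Proof.
move=> /gridP[i Ei vu] /gridP[j Ej uw] nwv nst.
(* Two steps in the same coordinate either return to [v] or go straight on. *)
have nji : j != i.
  apply/eqP=> ji; subst j.
  have [E|nE] := eqVneq (w i) (v i).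
    case/eqP: nwv; apply/ffunP=> k; have [->//|ki] := eqVneq k i.
    by rewrite -Ej // -Ei.
  case/negP: nst; apply/forallP=> k; have [->|ki] := eqVneq k i.
    have : w i <> v i :> nat by move/val_inj/eqP; rewrite (negbTE nE).
    by move=> ne; apply/eqP; lia.
  by rewrite Ei // Ej // addnn.
have nuwj : u j != w j by apply/eqP=> E; move: uw; rewrite E; lia.
have nvui : v i != u i by apply/eqP=> E; move: vu; rewrite E; lia.
have cE k : corner v u w k = if k == j then w k else v k.
  by rewrite ffunE; case: (altP (k =P j)) => [->|/Ej->]; rewrite ?eqxx ?(negbTE nuwj).
split.
- apply/gridP; exists j => [k /negbTE kj|]; first by rewrite cE kj.
  by rewrite cE eqxx Ei.
- apply/gridP; exists i => [k ki|].
    by rewrite cE; case: (altP (k =P j)) => // /Ej <-; rewrite Ei.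
  by rewrite cE eq_sym (negbTE nji) -Ej 1?eq_sym //; case: vu; [right | left].
apply/eqP=> /ffunP/(_ i); rewrite cE eq_sym (negbTE nji) => E.
by rewrite E eqxx in nvui.
Qed.

Lemma short_alternating_cycle (M : {set {set V}}) (m : V -> V) v :
  1 < n -> 2 < d ->
  (forall x y, ([set x; y] \in M) = (y == m x)) -> (forall x, grid x (m x)) ->
  (forall u, grid v u -> ~~ straight v u (m u)) ->
  exists c : seq V, [/\ alternating_cycle (@grid d n) M c,
    size c <= 2 * (2 * d - 1) & forall x, x \in c -> grid v x || grid v (m x)].
Proof.
move=> n1 d2 mP em nst; have mK := partner_inv mP.
(* It suffices to order some neighbours of [v] cyclically. They all have the colour opposite to [v],
   so they can be interleaved with their partners. *)
suff [s [us ss sd cs sv]] : exists s, [/\ uniq s, 1 < size s, size s <= 2 * d - 1,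
    cycle (fun u u' => grid (m u) u') s & {in s, forall u, grid v u}].
  exists (interleave m s); split.
  - apply: (interleave_alternating (col := fun x => odd_vertex x != odd_vertex v)) => //.
    move=> u /sv vu; rewrite (odd_vertex_grid (em u)) (odd_vertex_grid vu).
    by case: odd_vertex.
  - by rewrite size_interleave leq_mul2l.
  move=> x; rewrite mem_interleave // => /orP[]/sv->; rewrite ?orbT //.
pose t u := corner v u (m u).
have tP u : grid v u -> u != m v -> [/\ grid v (t u), grid (m u) (t u) & t u != u].
  move=> vu nu; apply: cornerP => //.
    by apply: contraNneq nu => <-; rewrite mK.
  exact: nst.
(* If the orbit of a neighbour under [t] reaches [m v], say [t u = m v], the
   vertices [m v], [v], [u], [m u] form an alternating 4-cycle; otherwise there
   is a periodic orbit avoiding [m v]. *)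
case: (boolP [exists u, [&& grid v u, u != m v & t u == m v]]) => [|noex].
  case/existsP=> u /and3P[vu nu /eqP tu]; have [_ mtu _] := tP u vu nu.
  exists [:: m v; u]; split=> //=.
  - by rewrite inE eq_sym nu.
  - by lia.
  - by rewrite mK vu -tu mtu.
  by move=> x; rewrite !inE => /orP[]/eqP->.
have tA u : grid v u && (u != m v) -> grid v (t u) && (t u != m v).
  case/andP=> vu nu; have [-> _ _] := tP u vu nu.
  by apply: contra noex => tu; apply/existsP; exists u; rewrite vu nu.
have [u0 vu0 nu0] := grid_nbr_neq n1 (ltnW d2) (em v).
have itA k : grid v (iter k t u0) && (iter k t u0 != m v).
  by elim: k => [|k IH] /=; [rewrite vu0 nu0 | apply: tA].
have [k [l per]] := iter_periodic t u0; set y := iter l t u0 in per.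
have cy : fcycle t (orbit t y) by apply/(orbitPcycle 3 0); exists k.
have oA x : x \in orbit t y -> grid v x && (x != m v).
  by case/trajectP=> i _ ->; rewrite -iterD.
have /andP[vy nvy] : grid v y && (y != m v) by apply: itA.
have [_ _ nty] := tP y vy nvy.
exists (orbit t y); split.
- exact: orbit_uniq.
(* An orbit of size one would make [y] a fixed point of [t]. *)
- rewrite ltnNge; apply: contra nty => sz.
  move: cy sz; rewrite /orbit -orderSpred /=; case: (order t y).-1 => //=.
  by rewrite andbT.
(* The orbit avoids [m v], which is one of the at most [2 * d] neighbours of [v]. *)
- have -> : size (orbit t y) = #|orbit t y|.
    by symmetry; apply/card_uniqP; apply: orbit_uniq.
  have := card_grid_nbhd v; rewrite (cardsD1 (m v)) inE em.
  suff : #|orbit t y| <= #|[set u | grid v u] :\ m v| by lia.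
  by apply: subset_leq_card; apply/subsetP=> x /oA; rewrite !inE andbC.
- apply: (sub_in_cycle _ (allss _) cy) => x z /oA/andP[vx nx] _ /= /eqP<-.
  by have [] := tP x vx nx.
by move=> x /oA/andP[].
Qed.

(** * Counting the vertices at which no dimer points *)

Section Counting.
Import Order.TTheory GRing.Theory Num.Theory.
Local Open Scope ring_scope.
Variable m : V -> V.
Hypotheses (mK : involutive m) (em : forall u, grid u (m u)).

(* [f (v i)] summed over [i] is a function on the box which is strictly concave
   along lines and nonnegative one step outside of the box. *)
Let f (x : int) : int := (x + 1) * (n%:Z - x).
Let weight v : int := \sum_i f (v i)%:Z.
(* The weight of the (possibly outer) point at which the dimer from [u] to
   [m u] points on the side of [u]. *)
Let rear u : int := \sum_i f (2 * (u i)%:Z - (m u i)%:Z).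

Definition unpointed : {set V} :=
  [set v | [forall u, grid v u ==> ~~ straight v u (m u)]].

(** Inside the box both factors of [f] lie between 1 and [n]. *)
Lemma weight_le v : weight v <= (d * n ^ 2)%:Z.
Proof.
have -> : (d * n ^ 2)%:Z = \sum_(i < d) (n ^ 2)%:Z.
  by rewrite sumr_const card_ord -mulr_natl; lia.
apply: ler_sum => i _; rewrite /f; have := ltn_ord (v i); move: (nat_of_ord (v i)) => a.
by nia.
Qed.

(** Each coordinate of the point behind [u] lies between -1 and [n], the two zeros of [f]. *)
Lemma rear_ge0 u : 0 <= rear u.
Proof.
apply: sumr_ge0 => i _; rewrite /f.
have [j E uv] := gridP _ _ (em u).
have := ltn_ord (u i); have := ltn_ord (m u i).
have : m u i = u i :> nat \/ m u i = (u i).+1 :> nat \/ u i = (m u i).+1 :> nat.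
  by have [->|/E->] := eqVneq i j; [right | left].
move: (nat_of_ord (u i)) (nat_of_ord (m u i)) => a b H lb la.
by apply: mulr_ge0; lia.
Qed.

Lemma rear_straight v u : straight v u (m u) -> rear u = weight v.
Proof.
move/forallP=> st; apply: eq_bigr => i _; congr f.
by have /eqP := st i; lia.
Qed.

Lemma rear_weight u : rear u + rear (m u) + 4 <= weight u + weight (m u).
Proof.
have [j E uv] := gridP _ _ (em u).
rewrite /rear /weight mK -!big_split (bigD1 j) //= [X in _ <= X](bigD1 j) //=.
set a := f _ + f _; set A := f _ + f _; set S := \sum_(i | _) _; set S' := \sum_(i | _) _.
(* In direction [j] the dimer occupies [b] and [b + 1] and points at [b - 1] and [b + 2]. As [f] has
   leading term [- x ^ 2], the two sums of values differ by exactly 4. *)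
have le_a : a + 4 <= A by rewrite /a /A /f; case: uv => ->; move: (nat_of_ord _) => b; nia.
have le_S : S <= S' by apply: ler_sum => i /E ->; rewrite /f; lia.
by lra.
Qed.

Lemma unpointed_large : (2 * n ^ d <= #|unpointed| * (d * n ^ 2))%N.
Proof.
have cardV : #|[set: V]| = (n ^ d)%N by rewrite cardsT card_ffun !card_ord.
(* Summing [rear_weight] over all vertices counts every dimer twice. *)
have sum_rear : 2 * (\sum_u rear u) + 4 * (n ^ d)%:Z <= 2 * \sum_u weight u.
  have reindex_m (g : V -> int) : 2 * (\sum_u g u) = \sum_u (g u + g (m u)).
    rewrite big_split /= [X in _ = _ + X](_ : _ = \sum_u g u); first by lra.
    by rewrite [RHS](reindex_inj (inv_inj mK)).
  rewrite !reindex_m (_ : 4 * _ = \sum_(u : V) 4); last first.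
    by rewrite sumr_const -cardsT cardV -[RHS]mulr_natr natz; lia.
  by rewrite -big_split; apply: ler_sum => u _; apply: rear_weight.
have pointed v : exists u, v \notin unpointed -> straight v u (m u).
  have [//|] := boolP (v \in unpointed); first by exists v.
  rewrite inE negb_forall => /existsP[u]; rewrite negb_imply negbK => /andP[_ st].
  by exists u.
have [p pP] := fin_all_exists pointed.
(* The point [v] is recovered from [u] as [2 u - m u], so [u] points at no other vertex. *)
have pinj : {in ~: unpointed &, injective p}.
  move=> v w; rewrite !in_setC => /pP/forallP sv /pP/forallP sw E; apply/ffunP=> i.
  by apply: val_inj => /=; have /eqP := sv i; have /eqP := sw i; rewrite E; lia.
have le1 : \sum_(v in ~: unpointed) weight v <= \sum_u rear u.
  rewrite (eq_bigr (rear \o p)); last first.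
    by move=> v; rewrite in_setC => /pP/rear_straight.
  (* The vertices outside the image of [p] contribute nonnegative terms. *)
  rewrite -(big_imset _ pinj) /= big_mkcond; apply: ler_sum => u _.
  by case: ifP => // _; apply: rear_ge0.
have le2 : \sum_(v in unpointed) weight v <= (#|unpointed| * (d * n ^ 2))%:Z.
  have -> : (#|unpointed| * (d * n ^ 2))%:Z = \sum_(v in unpointed) (d * n ^ 2)%:Z.
    by rewrite sumr_const -mulr_natl; lia.
  by apply: ler_sum => v _; apply: weight_le.
have : \sum_v weight v =
    \sum_(v in unpointed) weight v + \sum_(v in ~: unpointed) weight v.
  by rewrite (bigID (mem unpointed)) /=; congr (_ + _); apply: eq_bigl => v; rewrite in_setC.
by move: sum_rear le1 le2; lia.
Qed.

End Counting.

(** * Disjoint cycles in the grid and the final bounds *)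

Lemma disjoint_alternating_cycles (M : dimer_config (@grid d n)) : 2 < d -> 1 < n ->
  exists (I : {set V}) (c : V -> seq V),
    [/\ forall i, i \in I -> alternating_cycle (@grid d n) (val M) (c i),
        forall i, i \in I -> size (c i) <= 2 * (2 * d - 1),
        forall i j x, i \in I -> j \in I -> x \in c i -> x \in c j -> i = j
      & n ^ (d - 2) <= #|I| * (8 * d ^ 3)].
Proof.
move=> d2 n1.
have [m [mP em]] := perfect_matching_partner grid_sym grid_irr (valP M).
have mK := partner_inv mP.
have ex v : exists c : seq V, v \in unpointed m ->
    [/\ alternating_cycle (@grid d n) (val M) c,
    size c <= 2 * (2 * d - 1) & forall x, x \in c -> grid v x || grid v (m x)].
  have [|_] := boolP (v \in unpointed m); last by exists [::].
  rewrite inE => /'forall_implyP nst.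
  by have [c cP] := short_alternating_cycle n1 d2 mP em nst; exists c.
have [c cP] := fin_all_exists ex.
(* If [c v] passes through [x], then [v] is a neighbour of [x] or of [m x], which leaves at most
   [4 * d] choices of [v]. *)
pose near x := [set v | grid x v] :|: [set v | grid (m x) v].
have near_le x : #|near x| <= 4 * d.
  apply: leq_trans (leq_card_setU _ _).1 _.
  by rewrite (_ : 4 * d = 2 * d + 2 * d) ?leq_add ?card_grid_nbhd //; lia.
have c_size v : v \in unpointed m -> 0 < size (c v) <= 4 * d.
  case/cP=> /and4P[_ s2 _ _] sz _; rewrite (leq_trans _ s2) //=.
  by apply: leq_trans sz _; lia.
have c_near v x : v \in unpointed m -> x \in c v -> v \in near x.
  by case/cP=> _ _ H /H; rewrite !inE ![grid _ v]grid_sym.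
have [I [/subsetP IG disj large]] := disjoint_subfamily c_size c_near near_le.
exists I, c; split=> // [i /IG/cP[]|i /IG/cP[]|] //.
have := unpointed_large mK em; move: large.
have -> : n ^ d = n ^ (d - 2) * n ^ 2 by rewrite -expnD subnK // ltnW.
move: (n ^ (d - 2)) #|unpointed m| => N g le1 le2.
have {}le2 : 2 * N <= g * d.
  by rewrite -(leq_pmul2r (_ : 0 < n ^ 2)) ?expn_gt0 ?(ltnW n1) //; lia.
(* Here [2 * N <= g * d] and [g <= #|I| * (16 * d ^ 2)]; halving gives the factor [8 * d ^ 3]. *)
rewrite -(leq_pmul2l (isT : 0 < 2)); apply: leq_trans le2 _.
apply: leq_trans (leq_mul le1 (leqnn d)) _.
by rewrite !expnS expn0; move: #|I| => k; nia.
Qed.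

(** All dimers are parallel to the first axis and join the coordinates [2 k] and [2 k + 1]. *)
Lemma grid_dimer_config : 0 < d -> ~~ odd n -> exists M : dimer_config (@grid d n), True.
Proof.
move=> d0 n_even; pose i0 := Ordinal d0.
have flip_lt (a : 'I_n) : (if odd a then a.-1 else a.+1) < n.
  by have := ltn_ord a; case: ifP; lia.
pose flip a := Ordinal (flip_lt a).
have flipK : involutive flip.
  by move=> a; apply: val_inj => /=; case: (boolP (odd a)) => ?; case: ifP; lia.
pose m u : V := [ffun k => if k == i0 then flip (u k) else u k].
have mK : involutive m.
  by move=> u; apply/ffunP=> k; rewrite !ffunE; case: eqP => // _; rewrite flipK.
have em u : grid u (m u).
  apply/gridP; exists i0 => [k /negbTE ki|]; rewrite ffunE ?ki ?eqxx // /=.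
  by case: ifP; lia.
by exists (Sub _ (involution_matching mK em)).
Qed.

End Grid.

Import Order.TTheory GRing.Theory Num.Theory.

Theorem theorem1p4 (R : realType) (d n : nat)
    (hd : 3 <= d) (hn : 0 < n) (hn_even : ~~ odd n) :
  (n%:R ^+ (d - 2) / (320 * d%:R ^+ 6)
     <= (min_degree (@dimer_graph _ (@grid d n) (2 * d - 1)))%:R :> R)%R
  /\ (forall C : {set dimer_config (@grid d n)},
        C \in components (@dimer_graph _ (@grid d n) (2 * d - 1)) ->
        (2 `^ (n%:R ^+ (d - 2) / (320 * d%:R ^+ 6)) <= #|C|%:R :> R)%R).
Proof.
have n1 : 1 < n by case: n hn hn_even => // -[].
set B : R := (_ / _)%R.
have main (M : dimer_config (@grid d n)) : exists N : nat,
    [/\ (B <= N%:R)%R, N <= degree (@dimer_graph _ (@grid d n) (2 * d - 1)) M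
    & 2 ^ N <= #|[set M' | connect (@dimer_graph _ (@grid d n) (2 * d - 1)) M M']|].
  have [I [c [alt sz disj large]]] := disjoint_alternating_cycles M hd n1.
  exists #|I|; split.
  - have dR : (0 < d%:R :> R)%R by rewrite ltr0n; lia.
    rewrite /B ler_pdivrMr; last by rewrite mulr_gt0 ?exprn_gt0.
    (* The factor [8 * d ^ 3] is absorbed in [320 * d ^ 6]. *)
    rewrite -!natrX -!natrM ler_nat (leq_trans large) // leq_mul2l; apply/orP; right.
    by rewrite leq_mul // leq_exp2l; lia.
  - exact: leq_degree_disjoint alt sz disj.
  exact: leq_component_disjoint alt sz disj.
split; last first.
  move=> C /imsetP[M _ ->]; have [N [BN _ leC]] := main M.
  apply: le_trans (_ : ((2 ^ N)%:R <= _)%R); last by rewrite ler_nat.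
  rewrite natrX -powR_mulrn //; apply: ler_powR => //.
  by rewrite ler1n.
have [M0 _] := grid_dimer_config (ltn_trans (isT : 0 < 2) hd) hn_even.
(* The first case is the default value of the minimum, the number of all configurations; it is at
   least the degree of [M0]. *)
rewrite /min_degree; elim/big_ind: _ => [|a b Ba Bb|M _].
- have [N [BN le_deg _]] := main M0; apply: le_trans BN _; rewrite ler_nat.
  exact: leq_trans le_deg (max_card _).
- by rewrite /minn; case: ifP.
by have [N [BN le_deg _]] := main M; apply: le_trans BN _; rewrite ler_nat.
Qed.
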